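(* Let $R$ be a commutative self-injective ring, i.e. $R$ is injective as a module over itself. Then $R$ is a balanced ring.
   Context: Rings have an identity. The total ring of fractions $T(R)$ of a commutative ring $R$ is the localization $S^{-1}R$ where $S$ is the set of all non-zero-divisors of $R$. A commutative ring $R$ is called a balanced ring if the canonical ring map $R \to T(R)$, $r\mapsto r/1$, is an isomorphism. *)

(* Defs.v *)
From HB Require Import structures.
From mathcomp Require Import all_boot all_algebra.
From mathcomp Require Import boolp ring.

Set Implicit Arguments.
Unset Strict Implicit.
Unset Printing Implicit Defensive.

Import GRing.Theory.
Local Open Scope ring_scope.
Local Open Scope quotient_scope.

Definition injective_module (R : pzRingType) (E : lmodType R) : Prop :=
  forall (M N : lmodType R) (i : {linear M -> N}) (f : {linear M -> E}),
    injective i -> exists g : {linear N -> E}, g \o i =1 f.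

Definition self_injective (R : pzRingType) : Prop := injective_module R^o.

(* Localization S^-1 R at an arbitrary multiplicative subset S. Neither R nor
   S^-1 R is assumed nontrivial, hence the "Pz" structures. Decidability of the
   equivalence of fractions is classical. *)
Module Localization.
Section Localization.

Variables (R : comPzRingType) (S : mulrClosed R).

Record denom := Denom { den : R; denP : den \in S }.
HB.instance Definition _ := [isSub for den].
HB.instance Definition _ := [Choice of denom by <:].

Local Notation pre := (R * denom)%type.

Implicit Types (x y z : pre) (s t : denom).

Definition denom1 : denom := Denom (@rpred1 R S).
Definition denomM s t : denom := Denom (rpredM (denP s) (denP t)).

Definition equiv x y : bool :=
  `[< exists u : denom, den u * (x.1 * den y.2 - y.1 * den x.2) = 0 >].

Lemma equivP x y :
  reflect (exists u : denom, den u * (x.1 * den y.2) = den u * (y.1 * den x.2))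
          (equiv x y).
Proof.
apply: (iffP (asboolP _)) => -[u xy]; exists u.
  by apply/eqP; rewrite -subr_eq0 -mulrBr xy.
by rewrite mulrBr xy subrr.
Qed.

Lemma equiv_refl : reflexive equiv.
Proof. by move=> x; apply/equivP; exists denom1. Qed.

Lemma equiv_sym : symmetric equiv.
Proof. by move=> x y; apply/equivP/equivP => -[u xy]; exists u. Qed.

Lemma equiv_trans : transitive equiv.
Proof.
move=> [b [t tS]] [a [s sS]] [c [r rS]] /equivP[[u uS] /= xy] /equivP[[v vS] /= yz].
apply/equivP; exists (denomM (denomM (@Denom u uS) (@Denom v vS)) (@Denom t tS)) => /=.
have -> : u * v * t * (a * r) = v * r * (u * (a * t)) by ring.
rewrite xy.
have -> : v * r * (u * (b * s)) = u * s * (v * (b * r)) by ring.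
by rewrite yz; ring.
Qed.

Canonical equiv_equiv := EquivRel equiv equiv_refl equiv_sym equiv_trans.

Definition type := {eq_quot equiv}.
HB.instance Definition _ : EqQuotient _ equiv type := EqQuotient.on type.
HB.instance Definition _ := Choice.on type.

Definition frac (r : R) (s : denom) : type := \pi_type (r, s).

Implicit Types a b c : type.

Lemma fracP a : exists r s, a = frac r s.
Proof. by exists (repr a).1, (repr a).2; rewrite /frac -surjective_pairing reprK. Qed.

Lemma eq_frac r s r' s' :
  frac r s = frac r' s' <->
  exists u : denom, den u * (r * den s') = den u * (r' * den s).
Proof.
split=> [/eqmodP/equivP//|rr'].
by apply/eqmodP/(equivP (r, s) (r', s')).
Qed.

Definition zero : type := frac 0 denom1.
Definition one : type := frac 1 denom1.
Definition add a b : type :=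
  let: (r, s) := repr a in let: (r', s') := repr b in
  frac (r * den s' + r' * den s) (denomM s s').
Definition opp a : type := let: (r, s) := repr a in frac (- r) s.
Definition mul a b : type :=
  let: (r, s) := repr a in let: (r', s') := repr b in
  frac (r * r') (denomM s s').

Lemma repr_frac r s : exists r' s',
  repr (frac r s) = (r', s') /\
  exists u : denom, den u * (r' * den s) = den u * (r * den s').
Proof.
case E: (repr (frac r s)) => [r' s']; exists r', s'; split=> //.
by apply/eq_frac; rewrite /frac -E reprK.
Qed.

Lemma addE r s r' s' :
  add (frac r s) (frac r' s') = frac (r * den s' + r' * den s) (denomM s s').
Proof.
rewrite /add; have [p [t [-> [u up]]]] := repr_frac r s.
have [p' [t' [-> [u' up']]]] := repr_frac r' s'.
apply/eq_frac; exists (denomM u u') => /=.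
have -> : den u * den u' * ((p * den t' + p' * den t) * (den s * den s')) =
  den u' * den t' * den s' * (den u * (p * den s)) +
  den u * den t * den s * (den u' * (p' * den s')) by ring.
by rewrite up up'; ring.
Qed.

Lemma oppE r s : opp (frac r s) = frac (- r) s.
Proof.
rewrite /opp; have [p [t [-> [u up]]]] := repr_frac r s.
by apply/eq_frac; exists u; rewrite !mulNr !mulrN up.
Qed.

Lemma mulE r s r' s' :
  mul (frac r s) (frac r' s') = frac (r * r') (denomM s s').
Proof.
rewrite /mul; have [p [t [-> [u up]]]] := repr_frac r s.
have [p' [t' [-> [u' up']]]] := repr_frac r' s'.
apply/eq_frac; exists (denomM u u') => /=.
have -> : den u * den u' * (p * p' * (den s * den s')) =
  den u * (p * den s) * (den u' * (p' * den s')) by ring.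
by rewrite up up'; ring.
Qed.

Lemma addA : associative add.
Proof.
move=> a b c; have [r [s ->]] := fracP a; have [r' [s' ->]] := fracP b.
have [r'' [s'' ->]] := fracP c; rewrite !addE.
by apply/eq_frac; exists denom1 => /=; ring.
Qed.

Lemma addC : commutative add.
Proof.
move=> a b; have [r [s ->]] := fracP a; have [r' [s' ->]] := fracP b.
by rewrite !addE; apply/eq_frac; exists denom1 => /=; ring.
Qed.

Lemma add0 : left_id zero add.
Proof.
move=> a; have [r [s ->]] := fracP a.
by rewrite addE; apply/eq_frac; exists denom1 => /=; ring.
Qed.

Lemma addN : left_inverse zero opp add.
Proof.
move=> a; have [r [s ->]] := fracP a.
by rewrite oppE addE; apply/eq_frac; exists denom1 => /=; ring.
Qed.

HB.instance Definition _ := GRing.isZmodule.Build type addA addC add0 addN.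

Lemma mulA : associative mul.
Proof.
move=> a b c; have [r [s ->]] := fracP a; have [r' [s' ->]] := fracP b.
have [r'' [s'' ->]] := fracP c; rewrite !mulE.
by apply/eq_frac; exists denom1 => /=; ring.
Qed.

Lemma mulC : commutative mul.
Proof.
move=> a b; have [r [s ->]] := fracP a; have [r' [s' ->]] := fracP b.
by rewrite !mulE; apply/eq_frac; exists denom1 => /=; ring.
Qed.

Lemma mul1 : left_id one mul.
Proof.
move=> a; have [r [s ->]] := fracP a.
by rewrite mulE; apply/eq_frac; exists denom1 => /=; ring.
Qed.

Lemma mulDl : left_distributive mul add.
Proof.
move=> a b c; have [r [s ->]] := fracP a; have [r' [s' ->]] := fracP b.
have [r'' [s'' ->]] := fracP c; rewrite !(mulE, addE).
by apply/eq_frac; exists denom1 => /=; ring.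
Qed.

HB.instance Definition _ :=
  GRing.Zmodule_isComPzRing.Build type mulA mulC mul1 mulDl.

Definition can (r : R) : type := frac r denom1.

Lemma can_is_zmod_morphism : zmod_morphism can.
Proof.
move=> r r'; rewrite [RHS](_ : _ = add (can r) (opp (can r'))) // oppE addE.
by apply/eq_frac; exists denom1 => /=; ring.
Qed.

HB.instance Definition _ :=
  GRing.isZmodMorphism.Build R type can can_is_zmod_morphism.

Lemma can_is_monoid_morphism : monoid_morphism can.
Proof.
split=> // r r'; rewrite [RHS](_ : _ = mul (can r) (can r')) // mulE.
by apply/eq_frac; exists denom1 => /=; ring.
Qed.

HB.instance Definition _ :=
  GRing.isMonoidMorphism.Build R type can can_is_monoid_morphism.

End Localization.
End Localization.
HB.export Localization.

Definition non_zero_divisor (R : comPzRingType) : {pred R} :=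
  [pred s : R | `[< forall r : R, s * r = 0 -> r = 0 >]].

Lemma non_zero_divisor_mulr_closed (R : comPzRingType) :
  mulr_closed (@non_zero_divisor R).
Proof.
split=> [|s t /asboolP sN /asboolP tN]; apply/asboolP => r.
  by rewrite mul1r.
by rewrite -mulrA => /sN/tN.
Qed.

HB.instance Definition _ (R : comPzRingType) :=
  GRing.isMulClosed.Build R (@non_zero_divisor R)
    (@non_zero_divisor_mulr_closed R).

Definition total_fractions (R : comPzRingType) : comPzRingType :=
  Localization.type (@non_zero_divisor R).

Definition to_total_fractions (R : comPzRingType) :
    {rmorphism R -> total_fractions R} :=
  @Localization.can R (@non_zero_divisor R).

Definition balanced (R : comPzRingType) : Prop :=
  bijective (to_total_fractions R).

(* Main.v *)
Require Import Defs.
From mathcomp Require Import all_boot all_algebra.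
From mathcomp Require Import boolp.

Import GRing.Theory.
Local Open Scope ring_scope.

(* Multiplication by a non-zero-divisor s is an injective endomorphism of the
   module R, so the identity of R factors through it by injectivity: g (s x) = x
   for some linear g.  Then s * g 1 = g s = 1, so s is already invertible in R
   and r / s is the image of r * g 1. *)

Lemma non_zero_divisor_mul_inj (R : comPzRingType) (s : R) :
  s \in @non_zero_divisor R -> injective ( *%R s).
Proof.
move=> /asboolP sN x y /eqP; rewrite -subr_eq0 -mulrBr => /eqP/sN/eqP.
by rewrite subr_eq0 => /eqP.
Qed.

Lemma self_injective_inv (R : comPzRingType) (s : R) :
  self_injective R -> s \in @non_zero_divisor R -> exists t, s * t = 1.
Proof.
move=> Rinj sN.
(* Commutativity makes scaling by [s] linear; on [R^o] it is convertible to [*%R s], so the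
   injectivity lemma applies. *)
have [g gK] := Rinj R^o R^o ( *:%R s) idfun (non_zero_divisor_mul_inj R s sN).
exists (g 1).
by have := gK 1; rewrite /= linearZ.
Qed.

Theorem theorem4p16 (R : comPzRingType) : self_injective R -> balanced R.
Proof.
move=> Rinj.
have can_surj (a : total_fractions R) : exists r, to_total_fractions R r = a.
  have [r [[s sN] ->]] := Localization.fracP a.
  have [t st1] := self_injective_inv R s Rinj sN.
  exists (r * t); apply/Localization.eq_frac.
  exists (Localization.denom1 _) => /=.
  by rewrite -mulrA (mulrC t) st1.
have [g gK] := choice can_surj.
exists g => // r.
(* The section [g] is also a left inverse: [r] and [g] of its image have equal images, hence agree
   after multiplication by some non-zero-divisor [u], which cancels. *)
have /Localization.eq_frac[[u uN] /=] := gK (to_total_fractions R r).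
by move=> /(non_zero_divisor_mul_inj R u uN); rewrite !mulr1.
Qed.
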